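(* Let $(X,\le)$ be a finite regular poset of height $n$ with top level $\Omega$, let $t\in\{0,\ldots,n\}$, and let $\beta\in\mathbb{Z}^{\Omega}$ be an integer-valued $t$-design of index $\lambda$. For $s\in\{0,\ldots,t\}$ let $\lambda_s$ be the index of $\beta$ as an $s$-design. Then the following equivalent statements hold: (a) (Integrality conditions) For all $s\in\{0,\ldots,t\}$, $\lambda_s\in\mathbb{Z}$. (b) (Divisibility conditions) For all $s\in\{0,\ldots,t\}$, $\theta(t)\mid \lambda\,\theta(s)$. (c) $\dfrac{\theta(t)}{\gcd(\theta(0),\ldots,\theta(t))}\;\Big|\;\lambda$.
   Context: Let $(X,\le)$ be a finite poset with bottom element $\bot$. For $a\le b$ in $X$, the length $\ell(a,b)$ is the largest $r$ such that there is a chain $a=x_0<x_1<\cdots<x_r=b$. The height of $a$ is $h(a)=\ell(\bot,a)$, and $n=h(X)=\max_{x\in X}h(x)$ is the height of the poset. The levels are $X_r=\{x\in X: h(x)=r\}$ for $r\in\{0,\ldots,n\}$, and the top level is $\Omega=X_n$. The poset is called regular if the following hold. (R$\theta$) For all $r\in\{0,\ldots,n\}$, the number $\theta(r)=\#\{x\in\Omega: a\le x\}$ is the same for all $a\in X_r$. (R$\mu$) For all $r,s\in\{0,\ldots,n\}$, the number $\mu(r,s)=\#\{x\in X_s: a\le x\le b\}$ is the same for all $(a,b)\in X_r\times\Omega$ with $a\le b$. (R$\nu$) For all $r,s\in\{0,\ldots,n\}$, the number $\nu(r,s)=\#\{x\in X_r: x\le a\}$ is the same for all $a\in X_s$. For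 $\beta:\Omega\to\mathbb{C}$ and $a\in X$ put $\lambda^{(\beta)}(a)=\sum_{x\in\Omega,\,a\le x}\beta(x)$. The function $\beta$ is a $t$-design of index $\lambda$ if $\lambda^{(\beta)}(a)=\lambda$ for all $a\in X_t$. It is a known fact that in a finite regular poset a $t$-design of index $\lambda$ is also an $s$-design for every $s\in\{0,\ldots,t\}$, with index $\lambda_s=\lambda\,\theta(s)/\theta(t)$. *)

(* Defs.v *)
From HB Require Import structures.
From mathcomp Require Import all_boot all_order all_algebra.
From mathcomp Require Import reals.
From mathcomp.real_closed Require Import complex.

Set Implicit Arguments.
Unset Strict Implicit.
Unset Printing Implicit Defensive.

Import Order.TTheory GRing.Theory Num.Theory.
Local Open Scope ring_scope.

(* The largest r such that some chain a = x_0 < x_1 < ... < x_r = b exists; the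
   tuple c is (x_1, ..., x_r). The entries of a chain are distinct, so the bound
   r < #|X| excludes nothing. *)
Definition chain_length (d : Order.disp_t) (X : finBPOrderType d) (a b : X) : nat :=
  (\max_(r < #|X| |
     [exists c : r.-tuple X,
        path (fun x y : X => (x < y)%O) a c && (last a c == b)]) r)%N.

Definition height (d : Order.disp_t) (X : finBPOrderType d) (a : X) : nat :=
  chain_length \bot%O a.

Definition poset_height (d : Order.disp_t) (X : finBPOrderType d) : nat :=
  (\max_(x : X) height x)%N.

Definition level (d : Order.disp_t) (X : finBPOrderType d) (r : nat) : {set X} :=
  [set x | height x == r].

Definition top_level (d : Order.disp_t) (X : finBPOrderType d) : {set X} :=
  level X (poset_height X).

(* The common values required by the three regularity axioms are carried as
   parameters. Since all levels up to the height are nonempty, they are uniquely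
   determined for indices at most the height. *)
Record regular_poset (d : Order.disp_t) (X : finBPOrderType d)
    (theta : nat -> nat) (mu nu : nat -> nat -> nat) : Prop := {
  regular_theta : forall (r : nat) (a : X),
    (r <= poset_height X)%N -> a \in level X r ->
    #|[set x in top_level X | (a <= x)%O]| = theta r;
  regular_mu : forall (r s : nat) (a b : X),
    (r <= poset_height X)%N -> (s <= poset_height X)%N ->
    a \in level X r -> b \in top_level X -> (a <= b)%O ->
    #|[set x in level X s | (a <= x <= b)%O]| = mu r s;
  regular_nu : forall (r s : nat) (a : X),
    (r <= poset_height X)%N -> (s <= poset_height X)%N ->
    a \in level X s ->
    #|[set x in level X r | (x <= a)%O]| = nu r s
}.

Definition top_sum (d : Order.disp_t) (X : finBPOrderType d) (R : realType)
    (beta : {x : X | x \in top_level X} -> R[i]) (a : X) : R[i] :=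
  \sum_(x : {x : X | x \in top_level X} | (a <= val x)%O) beta x.

Definition is_design (d : Order.disp_t) (X : finBPOrderType d) (R : realType)
    (beta : {x : X | x \in top_level X} -> R[i]) (t : nat) (lambda : R[i]) : Prop :=
  forall a : X, a \in level X t -> top_sum beta a = lambda.

Definition is_integer (R : realType) (z : R[i]) : Prop :=
  exists m : int, z = m%:~R.

(* Divisibility in the integers: in particular z is an integer. *)
Definition divides (R : realType) (k : nat) (z : R[i]) : Prop :=
  exists m : int, z = k%:R * m%:~R.

(* lambda_s is the index of beta as an s-design. Levels up to the height are
   nonempty, so this index is unique; the existential also asserts that beta is
   an s-design. *)
Definition integrality_conditions (d : Order.disp_t) (X : finBPOrderType d)
    (R : realType) (beta : {x : X | x \in top_level X} -> R[i]) (t : nat) : Prop :=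
  forall s : nat, (s <= t)%N ->
    exists lambda_s : R[i], is_design beta s lambda_s /\ is_integer lambda_s.

Definition divisibility_conditions (R : realType) (theta : nat -> nat) (t : nat)
    (lambda : R[i]) : Prop :=
  forall s : nat, (s <= t)%N -> divides (theta t) (lambda * (theta s)%:R).

Definition gcd_condition (R : realType) (theta : nat -> nat) (t : nat)
    (lambda : R[i]) : Prop :=
  divides (theta t %/ \big[gcdn/0]_(s < t.+1) theta s)%N lambda.

(* Main.v *)
Require Import Defs.
From HB Require Import structures.
From mathcomp Require Import all_boot all_order all_algebra.
From mathcomp Require Import reals.
From mathcomp Require Import zify.
From mathcomp.real_closed Require Import complex.

(** Write [n] for the height of the poset. A chain of length [n] from the bottom
    element meets every level exactly once, so no level is empty, and comparing
    the entries of that one chain shows that [theta s] and [mu s t] are nonzero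
    for [s <= t <= n].

    Fix [a] of height [s] and let [N] be the number of elements of height [t]
    above [a]. Counting pairs [a <= b <= x] with [b] of height [t] and [x] in the
    top level, with weight [beta x], gives [N * lambda = mu s t * top_sum beta a]
    ([design_double_count]). Constant weight 1 is itself a [t]-design, of index
    [theta t], so the same identity gives [N * theta t = mu s t * theta s]. Since
    [mu s t] is nonzero, eliminating [N] leaves
    [top_sum beta a * theta t = lambda * theta s] ([top_sum_theta]), in which [a]
    occurs only through its height: [beta] is an [s]-design.

    This relation, with [theta t] cancelled, makes integrality of the index of
    [beta] as an [s]-design the same as divisibility of [lambda * theta s] by
    [theta t]. The gcd form is pure arithmetic: the case [s = t] forces [lambda]
    to be an integer, and an integer divides all [lambda * theta s] exactly when
    it divides [lambda] times the gcd of the [theta s]. Finally, for integral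
    [beta] each [top_sum beta a] is an integer. *)

Set Implicit Arguments.
Unset Strict Implicit.
Unset Printing Implicit Defensive.

Import Order.TTheory GRing.Theory Num.Theory.
Local Open Scope ring_scope.

(** * Heights and maximal chains *)

Lemma chain_size_lt (d : Order.disp_t) (X : finPOrderType d) (x : X)
    (c : seq X) :
  path (fun x y : X => (x < y)%O) x c -> (size c < #|X|)%N.
Proof.
move=> c_path; have c_uniq : uniq (x :: c) by apply: lt_sorted_uniq.
by rewrite -[(size c).+1]/(size (x :: c)) -(card_uniqP c_uniq) max_card.
Qed.

Lemma chain_size_height (d : Order.disp_t) (X : finBPOrderType d) (x : X)
    (c : seq X) :
  path (fun x y : X => (x < y)%O) \bot%O c -> last \bot%O c = x ->
  (size c <= height x)%N.
Proof.
move=> c_path c_last; rewrite /height /chain_length.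
apply: (leq_bigmax_cond (Ordinal (chain_size_lt c_path))).
by apply/existsP; exists (in_tuple c); rewrite c_path c_last eqxx.
Qed.

Lemma height_chain (d : Order.disp_t) (X : finBPOrderType d) (x : X) :
  exists c : seq X,
    [/\ path (fun x y : X => (x < y)%O) \bot%O c, last \bot%O c = x
      & size c = height x].
Proof.
(* A maximum over an empty set would be 0 by default, hence attained by no
   chain: this excludes it. *)
have [c [c_path c_last]] : exists c : seq X,
    path (fun x y : X => (x < y)%O) \bot%O c /\ last \bot%O c = x.
  have [-> | x_neq] := eqVneq x \bot%O; first by exists [::].
  by exists [:: x]; rewrite /= lt0x x_neq.
pose P := [pred r : 'I_#|X| | [exists c : r.-tuple X,
  path (fun x y : X => (x < y)%O) \bot%O c && (last \bot%O c == x)]].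
have P_gt0 : (0 < #|P|)%N.
  apply/card_gt0P; exists (Ordinal (chain_size_lt c_path)); rewrite inE.
  by apply/existsP; exists (in_tuple c); rewrite c_path c_last eqxx.
have [r] := eq_bigmax_cond (@nat_of_ord _) P_gt0.
rewrite inE => /existsP[e /andP[e_path /eqP e_last]] heightE.
by exists e; split=> //; rewrite size_tuple; apply/esym.
Qed.

(** The [r]-th entry of a chain of maximal length has height exactly [r]: a longer
    chain below it, continued by the rest of the maximal chain, would be too
    long. *)
Lemma full_chain (d : Order.disp_t) (X : finBPOrderType d) :
  exists f : nat -> X,
    (forall r, (r <= poset_height X)%N -> f r \in level X r) /\
    (forall r s, (r <= s <= poset_height X)%N -> (f r <= f s)%O).
Proof.
have [x _ heightX] : {x : X | x \in X & poset_height X = height x}.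
  by apply: eq_bigmax_cond; apply/card_gt0P; exists \bot%O.
have [c [c_path c_last c_size]] := height_chain x.
exists (nth \bot%O (\bot%O :: c)); rewrite heightX -c_size; split; last first.
  move=> r s /andP[rs sc].
  have c_sorted : sorted (<=%O : rel X) (\bot%O :: c).
    by apply: (sub_path _ c_path) => y z; apply: ltW.
  apply: (sorted_leq_nth le_trans le_refl) => //; rewrite inE /= ltnS //.
  exact: leq_trans sc.
move=> r rc; rewrite inE.
have y_last : last \bot%O (take r c) = nth \bot%O (\bot%O :: c) r.
  rewrite (last_nth \bot%O) size_takel //.
  by rewrite -[_ :: take r c]/(take r.+1 (\bot%O :: c)) nth_take.
rewrite eqn_leq; apply/andP; split; last first.
  rewrite -[X in (X <= _)%N](size_takel rc).
  by apply: chain_size_height; first exact: take_path.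
have [e [e_path e_last e_size]] := height_chain (nth \bot%O (\bot%O :: c) r).
have : (size (e ++ drop r c) <= height x)%N.
  move: c_path c_last; rewrite -{1 2}(cat_take_drop r c) cat_path last_cat.
  rewrite y_last => /andP[_ d_path] d_last.
  by apply: chain_size_height; rewrite ?cat_path ?last_cat e_last ?e_path.
by rewrite size_cat size_drop e_size -c_size; lia.
Qed.

(** * Double counting *)

Lemma theta_gt0 (d : Order.disp_t) (X : finBPOrderType d)
    (theta : nat -> nat) (mu nu : nat -> nat -> nat) (r : nat) :
  regular_poset X theta mu nu -> (r <= poset_height X)%N -> (0 < theta r)%N.
Proof.
move=> X_regular r_le; have [f [f_level f_le]] := full_chain X.
rewrite -(regular_theta X_regular r_le (f_level r r_le)).
apply/card_gt0P; exists (f (poset_height X)).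
by rewrite inE f_level // f_le // r_le leqnn.
Qed.

Lemma mu_gt0 (d : Order.disp_t) (X : finBPOrderType d)
    (theta : nat -> nat) (mu nu : nat -> nat -> nat) (s t : nat) :
  regular_poset X theta mu nu -> (s <= t <= poset_height X)%N ->
  (0 < mu s t)%N.
Proof.
move=> X_regular /andP[st t_le]; have s_le := leq_trans st t_le.
have [f [f_level f_le]] := full_chain X.
rewrite -(regular_mu X_regular s_le t_le (f_level s s_le)
  (f_level _ (leqnn _))) ?f_le ?s_le ?leqnn //.
by apply/card_gt0P; exists (f t); rewrite inE f_level // !f_le ?st ?t_le ?leqnn.
Qed.

(** Both sides count the pairs [a <= b <= x] with [b] of height [t] and [x] in the
    top level, weighted by [beta x]. *)
Lemma design_double_count (R : realType) (d : Order.disp_t)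
    (X : finBPOrderType d) (theta : nat -> nat) (mu nu : nat -> nat -> nat)
    (s t : nat) (beta : {x : X | x \in top_level X} -> R[i]) (lambda : R[i])
    (a : X) :
  regular_poset X theta mu nu ->
  (s <= poset_height X)%N -> (t <= poset_height X)%N -> a \in level X s ->
  is_design beta t lambda ->
  #|[set b in level X t | (a <= b)%O]|%:R * lambda
    = (mu s t)%:R * top_sum beta a.
Proof.
move=> X_regular s_le t_le a_s beta_design.
transitivity (\sum_(b in [set b in level X t | (a <= b)%O]) top_sum beta b).
  rewrite (eq_bigr (fun=> lambda)) ?sumr_const ?mulr_natl // => b.
  by rewrite inE => /andP[b_t _]; apply: beta_design.
rewrite /top_sum (exchange_big_dep (fun x => (a <= val x)%O)) /=; last first.
  by move=> b x; rewrite inE => /andP[_ ab]; apply: le_trans.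
rewrite mulr_sumr; apply: eq_bigr => x ax.
rewrite -(regular_mu X_regular s_le t_le a_s (valP x) ax) sumr_const mulr_natl.
by congr (_ *+ _); apply: eq_card => b; rewrite unfold_in /= !inE andbA.
Qed.

Lemma top_sum_one (R : realType) (d : Order.disp_t) (X : finBPOrderType d)
    (theta : nat -> nat) (mu nu : nat -> nat -> nat) (r : nat) :
  regular_poset X theta mu nu -> (r <= poset_height X)%N ->
  is_design (fun _ : {x : X | x \in top_level X} => 1 : R[i]) r (theta r)%:R.
Proof.
move=> X_regular r_le a a_r; rewrite /top_sum sumr_const.
rewrite -(regular_theta X_regular r_le a_r) -(card_imset _ val_inj).
congr (_%:R); apply: eq_card => x; rewrite [RHS]in_set.
apply/imsetP/andP => [[y ay ->]|[x_top ax]]; first by split; first exact: valP.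
by exists (Sub x x_top).
Qed.

(** The same count for [beta] and for constant weight 1 involves the same number of
    elements of height [t] above [a], which is eliminated between the two. *)
Lemma top_sum_theta (R : realType) (d : Order.disp_t) (X : finBPOrderType d)
    (theta : nat -> nat) (mu nu : nat -> nat -> nat) (s t : nat)
    (beta : {x : X | x \in top_level X} -> R[i]) (lambda : R[i]) (a : X) :
  regular_poset X theta mu nu -> (s <= t <= poset_height X)%N ->
  a \in level X s -> is_design beta t lambda ->
  top_sum beta a * (theta t)%:R = lambda * (theta s)%:R.
Proof.
move=> X_regular st_le a_s beta_design.
have mu_neq0 : (mu s t)%:R != 0 :> R[i].
  by rewrite pnatr_eq0 -lt0n (mu_gt0 X_regular).
have /andP[st t_le] := st_le; have s_le := leq_trans st t_le.
have beta_count := design_double_count X_regular s_le t_le a_s beta_design.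
have := design_double_count X_regular s_le t_le a_s
  (top_sum_one R X_regular t_le).
rewrite (top_sum_one R X_regular s_le a_s) => theta_count.
apply: (mulfI mu_neq0).
by rewrite mulrA -beta_count mulrAC theta_count mulrAC -mulrA.
Qed.

(** * Integrality and divisibility *)

Lemma top_sum_integer (R : realType) (d : Order.disp_t) (X : finBPOrderType d)
    (beta : {x : X | x \in top_level X} -> R[i]) (a : X) :
  (forall x, is_integer (beta x)) -> is_integer (top_sum beta a).
Proof.
move=> beta_int; apply: big_ind => //; first by exists 0.
by move=> _ _ [m ->] [k ->]; exists (m + k); rewrite intrD.
Qed.

Lemma integrality_divisibility (R : realType) (d : Order.disp_t)
    (X : finBPOrderType d) (theta : nat -> nat) (mu nu : nat -> nat -> nat)
    (t : nat) (beta : {x : X | x \in top_level X} -> R[i]) (lambda : R[i]) :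
  regular_poset X theta mu nu -> (t <= poset_height X)%N ->
  is_design beta t lambda ->
  integrality_conditions beta t <-> divisibility_conditions theta t lambda.
Proof.
move=> X_regular t_le beta_design.
have theta_neq0 : (theta t)%:R != 0 :> R[i].
  by rewrite pnatr_eq0 -lt0n (theta_gt0 X_regular).
have le_height s : (s <= t)%N -> (s <= t <= poset_height X)%N by move=> ->.
split=> [beta_int | theta_dvd] s st; have st_le := le_height s st.
  have [f [f_level _]] := full_chain X.
  have f_s := f_level s (leq_trans st t_le).
  have [lambda_s [s_design [m Em]]] := beta_int s st; exists m.
  rewrite -Em -(s_design _ f_s) [RHS]mulrC.
  by rewrite (top_sum_theta X_regular st_le f_s beta_design).
have [m Em] := theta_dvd s st; exists m%:~R; split; last by exists m.
move=> a a_s; apply: (mulIf theta_neq0).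
by rewrite (top_sum_theta X_regular st_le a_s beta_design) Em mulrC.
Qed.

Lemma divides_int (R : realType) (k : nat) (z : int) :
  divides k (z%:~R : R[i]) <-> (k %| `|z|)%N.
Proof.
rewrite -[(k %| _)%N]/(k%:Z %| z)%Z; split=> [[m Em]|/dvdzP[m ->]].
  apply/dvdzP; exists m; apply: (@intr_inj R[i]).
  by rewrite Em intrM mulrC.
by exists m; rewrite intrM mulrC.
Qed.

(** Taking [s = t] in the divisibility conditions and cancelling [theta t] shows
    that [lambda] is an integer, so that both conditions become divisibilities
    between natural numbers, where a gcd commutes with multiplication by the
    absolute value of [lambda]. *)
Lemma divisibility_gcd (R : realType) (theta : nat -> nat) (t : nat)
    (lambda : R[i]) :
  (0 < theta t)%N ->
  divisibility_conditions theta t lambda <-> gcd_condition theta t lambda.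
Proof.
move=> theta_gt0; rewrite /gcd_condition.
set g := \big[gcdn/0%N]_(s < t.+1) theta s.
have g_dvd s : (s <= t)%N -> (g %| theta s)%N.
  by move=> st; apply: (biggcdn_inf (Ordinal (st : s < t.+1)%N)).
have g_gt0 : (0 < g)%N := dvdn_gt0 theta_gt0 (g_dvd t (leqnn t)).
have theta_neq0 : (theta t)%:R != 0 :> R[i] by rewrite pnatr_eq0 -lt0n.
suff nat_equiv (z : int) :
    divisibility_conditions theta t (z%:~R : R[i]) <->
    divides (theta t %/ g) (z%:~R : R[i]).
  split=> [theta_dvd | [m Em]].
    have [m Em] := theta_dvd t (leqnn t).
    have lambdaE : lambda = m%:~R by apply: (mulIf theta_neq0); rewrite Em mulrC.
    by rewrite lambdaE in theta_dvd *; apply/nat_equiv.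
  have lambdaE : lambda = ((theta t %/ g)%:Z * m)%:~R by rewrite intrM.
  by rewrite lambdaE; apply/nat_equiv; exists m; rewrite -lambdaE.
have int_divides s :
    divides (theta t) (z%:~R * (theta s)%:R : R[i]) <->
    (theta t %| `|z| * theta s)%N.
  have -> : z%:~R * (theta s)%:R = (z * (theta s)%:Z)%:~R :> R[i].
    by rewrite intrM.
  by rewrite -[(theta s)%N in X in _ <-> X]absz_nat -abszM; apply: divides_int.
have gcd_mul : (`|z| * g)%N = \big[gcdn/0%N]_(s < t.+1) (`|z| * theta s)%N.
  rewrite /g.
  exact: (big_morph (muln `|z|) (fun p q => muln_gcdr _ p q) (muln0 _)).
rewrite divides_int dvdn_divLR ?g_dvd // gcd_mul.
split=> [theta_dvd | /dvdn_biggcdP theta_dvd s st].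
  by apply/dvdn_biggcdP => s _; apply/int_divides/theta_dvd; rewrite -ltnS.
by apply/int_divides; apply: (theta_dvd (Ordinal (st : s < t.+1)%N)).
Qed.

Theorem theorem1 (R : realType) (d : Order.disp_t) (X : finBPOrderType d)
    (theta : nat -> nat) (mu nu : nat -> nat -> nat)
    (X_regular : regular_poset X theta mu nu)
    (t : nat) (t_le : (t <= poset_height X)%N)
    (beta : {x : X | x \in top_level X} -> R[i]) (lambda : R[i])
    (beta_design : is_design beta t lambda) :
  [/\ integrality_conditions beta t <-> divisibility_conditions theta t lambda,
      divisibility_conditions theta t lambda <-> gcd_condition theta t lambda
    & (forall x, is_integer (beta x)) ->
      [/\ integrality_conditions beta t,
          divisibility_conditions theta t lambda
        & gcd_condition theta t lambda]].
Proof.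
have theta_t := theta_gt0 X_regular t_le.
have int_div := integrality_divisibility X_regular t_le beta_design.
have div_gcd := divisibility_gcd lambda theta_t.
split=> // beta_int.
have int_cond : integrality_conditions beta t.
  (* [beta] is an [s]-design by [top_sum_theta]; its index is read off at any
     element of height [s]. *)
  move=> s st; have [f [f_level _]] := full_chain X.
  have f_s := f_level s (leq_trans st t_le).
  have st_le : (s <= t <= poset_height X)%N by rewrite st.
  exists (top_sum beta (f s)); split; last exact: top_sum_integer.
  have theta_neq0 : (theta t)%:R != 0 :> R[i] by rewrite pnatr_eq0 -lt0n.
  move=> a a_s; apply: (mulIf theta_neq0).
  by rewrite !(top_sum_theta X_regular st_le _ beta_design).
have div_cond := (int_div.1 int_cond).
by split=> //; apply/div_gcd.
Qed.
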